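(* Let $\mathbb{T}=\mathbb{N}_0$ and suppose there is a sequence $\{\bar g(t)\}_{t\in\mathbb{T}}\in H_{\mathcal{F}}$ such that $|\tilde g_{i,j}(t)|\le\bar g(t)$ for all $(t,i,j)\in\mathbb{T}\times\mathcal{I}^2$. Let $$V_t^{i} = \operatorname*{ess\,inf}_{\xi\in\mathcal{U}^i_t}\varrho_{t}\big(\tilde g_{\xi_{t-1},\xi_t}(t),\tilde g_{\xi_{t},\xi_{t+1}}(t+1),\ldots\big)$$ be the value process of the infinite-horizon switching problem. For $(t,r)\in\mathbb{T}^2$ set $\hat V^i_{t,r}=\varrho_t(g_i(t),g_i(t+1),\ldots)$ if $t>r$, and define recursively for $t\le r$ $$\hat V_{t,r}^{i}=\min_{j\in\mathcal{I}} \rho_t\big(\tilde g_{i,j}(t)+\hat V^{j}_{t+1,r}\big).$$ Then the pointwise (almost sure) limits $\tilde V^i_t:=\lim_{r\to\infty}\hat V^i_{t,r}$, $t\in\mathbb{T}$, $i\in\mathcal{I}$, exist and satisfy $\tilde V^i_t=V^i_t$ for all $t\in\mathbb{T}$ and $i\in\mathcal{I}$. Furthermore, starting from any $t\in\mathbb{T}$ and $i\in\mathcal{I}$, the limit family defines an optimal strategy $\xi^*\in\mathcal{U}^i_t$ (i.e. one attaining the essential infimum defining $V^i_t$) as follows: $$\begin{cases}\xi^*_r=i,& r<t,\\ \xi^*_r\in\arg\min_{j\in\mathcal{I}}\rho_r\big(\tilde g_{\xi^*_{r-1},j}(r)+\tilde V^j_{r+1}\big),& r\ge t,\end{cases}$$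 where each $\xi^*_r$, $r\ge t$, is a $\mathcal{G}_r$-measurable selection from the indicated (random) set of minimisers.
   Context: $(\Omega,\mathcal{F},\mathbb{P})$ is a probability space and $\mathbb{G}=\{\mathcal{G}_t\}_{t\in\mathbb{T}}$ is a filtration of sub-$\sigma$-algebras of $\mathcal{F}$. $L^\infty_{\mathcal{H}}$ denotes the space of essentially bounded $\mathcal{H}$-measurable random variables. All (in)equalities between random variables are $\mathbb{P}$-almost sure. A $\mathbb{G}$-conditional risk mapping is a family $\rho=\{\rho_t\}_{t\in\mathbb{T}}$, $\rho_t:L^\infty_{\mathcal{F}}\to L^\infty_{\mathcal{G}_t}$, satisfying for all $t$: normalisation $\rho_t(0)=0$; conditional translation invariance $\rho_t(Z+W)=Z+\rho_t(W)$ for $W\in L^\infty_{\mathcal{F}}$, $Z\in L^\infty_{\mathcal{G}_t}$; monotonicity: $W\le Z$ implies $\rho_t(W)\le\rho_t(Z)$ for $W,Z\in L^\infty_{\mathcal F}$. Such a $\rho$ is fixed. The aggregated risk mapping is $\rho_{t,t}(W_t)=\rho_t(W_t)$ and, for $s<t$, $\rho_{s,t}(W_s,\ldots,W_t)=\rho_s\big(W_s+\rho_{s+1}(W_{s+1}+\cdots+\rho_{t-1}(W_{t-1}+\rho_t(W_t))\cdots)\big)$. The infinite-horizon aggregated risk mapping is $\varrho_s(W_s,W_{s+1},\ldots)=\limsup_{t\to\infty}\rho_{s,t}(W_s,\ldots,W_t)$ for sequences in $L^\infty_{\mathcal{F}}$. $H_{\mathcal{F}}$ is the set of sequences $W=\{W_t\}_{t\in\mathbb{T}}$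 in $L^\infty_{\mathcal{F}}$ for which there is a non-negative deterministic sequence $\{k_t\}_{t\in\mathbb{T}}$ with $\sum_t k_t<\infty$ and $|W_t|\le k_t$ for all $t$. $\mathcal{I}=\{1,\ldots,m\}$ is a finite set of modes; $g_i(t)$ and $c_{i,j}(t)$ ($i,j\in\mathcal{I}$, $t\in\mathbb{T}$) are random variables in $L^\infty_{\mathcal{F}}$ (not assumed $\mathbb{G}$-adapted) with $c_{i,i}(t)=0$, and $\tilde g_{i,j}(t)=g_j(t)+c_{i,j}(t)$. A strategy is an $\mathcal{I}$-valued, $\mathbb{G}$-adapted random sequence $\xi=(\xi_t)_{t\in\{-1\}\cup\mathbb{T}}$ (with $\xi_{-1}$ the initial mode), and $\mathcal{U}^i_t$ is the set of strategies with $\xi_{t-1}=i$. For a random $\mathcal{G}_s$-measurable $\mathcal{I}$-valued index $\eta$, $\rho_s(\tilde g_{\eta,j}(s)+\cdot)$ is evaluated as $\sum_{k}\mathbf{1}_{\{\eta=k\}}\rho_s(\tilde g_{k,j}(s)+\cdot)$. *)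

(* Defs.v *)
From HB Require Import structures.
From mathcomp Require Import all_boot all_order all_algebra.
From mathcomp Require Import all_classical all_reals all_analysis.
From mathcomp Require Import measurable_realfun.

Set Implicit Arguments.
Unset Strict Implicit.
Unset Printing Implicit Defensive.

Import Order.TTheory GRing.Theory Num.Theory.
Import numFieldNormedType.Exports.

Local Open Scope classical_set_scope.
Local Open Scope ring_scope.

(* Random variables are represented by functions, and all relations between
   them are almost sure.  L^infty_F is [Lfun P +oo]. *)

Section ConditionalRisk.
Context (R : realType) (d : measure_display) (Omega : measurableType d).
Variable P : probability Omega R.

Definition filtration (G : nat -> set (set Omega)) : Prop :=
  [/\ forall t, sigma_algebra [set: Omega] (G t),
      forall t, G t `<=` measurable
    & forall s t, (s <= t)%N -> G s `<=` G t].

(* L^infty_H for a sub-sigma-algebra H; [g_sigma_algebraType H] is Omega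
   equipped with the sigma-algebra generated by H, i.e. with H itself. *)
Definition Linfty (H : set (set Omega)) : set (Omega -> R) :=
  [set X | X \in Lfun P +oo /\
           measurable_fun [set: g_sigma_algebraType H]
                          (X : g_sigma_algebraType H -> R)].

(* [rho] acts on representatives; [crm_le] (used in both directions) makes it
   compatible with almost sure equality. *)
Record conditional_risk_mapping (G : nat -> set (set Omega))
    (rho : nat -> (Omega -> R) -> (Omega -> R)) : Prop := {
  crm_range : forall t W, W \in Lfun P +oo -> Linfty (G t) (rho t W) ;
  crm_normalised : forall t, \forall w \ae P, rho t (cst 0) w = 0 ;
  crm_translation : forall t Z W, Linfty (G t) Z -> W \in Lfun P +oo ->
    \forall w \ae P, rho t (Z \+ W) w = Z w + rho t W w ;
  crm_le : forall t W Z, W \in Lfun P +oo -> Z \in Lfun P +oo ->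
    (\forall w \ae P, W w <= Z w) ->
    \forall w \ae P, rho t W w <= rho t Z w }.

Definition summably_bounded (W : nat -> Omega -> R) : Prop :=
  (forall t, W t \in Lfun P +oo) /\
  exists k : nat -> R,
    [/\ forall t, 0 <= k t, cvgn (series k)
      & forall t, \forall w \ae P, `|W t w| <= k t].

(* Essential infimum of a family of extended-real random variables. *)
Definition is_ess_infimum (Phi : set (Omega -> \bar R)) (V : Omega -> \bar R)
    : Prop :=
  [/\ measurable_fun [set: Omega] V,
      forall X, Phi X -> \forall w \ae P, (V w <= X w)%E
    & forall Y, measurable_fun [set: Omega] Y ->
        (forall X, Phi X -> \forall w \ae P, (Y w <= X w)%E) ->
        \forall w \ae P, (Y w <= V w)%E].

(* A version of the essential infimum; see [ess_infimumP]. *)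
Definition ess_infimum (Phi : set (Omega -> \bar R)) : Omega -> \bar R :=
  xget (cst +oo%E) (is_ess_infimum Phi).

Lemma measurable_contract (V : Omega -> \bar R) :
  measurable_fun [set: Omega] V -> measurable_fun [set: Omega] (@contract R \o V).
Proof.
move=> mV; apply: (measurability _ (RGenCInfty.measurableE R)) => //.
move=> _ [_ [r ->] <-].
have [r1|r1] := boolP (`|r| <= 1).
  rewrite [X in measurable X](_ : _ = setT `&` [set w | (@expand R r <= V w)%E]).
    exact: measurable_realfun.emeasurable_fun_c_infty.
  apply/seteqP; split => w /= [_]; rewrite in_itv /= andbT => H; split => //;
    move: H; rewrite ?in_itv /= ?andbT le_expandLR //.
rewrite -ltNge lter_normr in r1; case/orP: r1 => r1.
  rewrite [X in measurable X](_ : _ = set0) //.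
  apply/seteqP; split => w //= [_]; rewrite in_itv /= andbT => rV.
  have := contract_le1 (V w); rewrite ler_norml => /andP[_ V1].
  by have := le_lt_trans (le_trans rV V1) r1; rewrite ltxx.
rewrite [X in measurable X](_ : _ = setT) //.
apply/seteqP; split => w //= _; split => //; rewrite in_itv /= andbT.
have := contract_le1 (V w); rewrite ler_norml => /andP[V1 _].
by apply: le_trans V1; rewrite lerNr ltW.
Qed.

Lemma ess_infimumP (Phi : set (Omega -> \bar R)) :
  (forall X, Phi X -> measurable_fun [set: Omega] X) ->
  is_ess_infimum Phi (ess_infimum Phi).
Proof.
move=> mPhi; suff: exists V, is_ess_infimum Phi V by move=> exV; apply: xgetPex exV.
have [[X1 PX1]|Phi0] := pselect (exists X0, Phi X0); last first.
  exists (cst +oo%E); split => [||Y mY _]; first exact: measurable_cst.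
    by move=> X PX; exfalso; apply: Phi0; exists X.
  by apply: aeW => w; rewrite leey.
pose low (S : nat -> Omega -> \bar R) w := einfs (S ^~ w) 0.
have lowE S n w : (low S w <= S n w)%E by apply: ereal_inf_lbound; exists n.
have lowG S w y : (forall n, (y <= S n w)%E) -> (y <= low S w)%E.
  by move=> yS; apply: le_ereal_inf_tmp => _ [n _ <-].
pose J S := (\int[P]_w (@contract R (low S w))%:E)%E.
pose inPhi (S : nat -> Omega -> \bar R) := forall n, Phi (S n).
have mlow S : inPhi S -> measurable_fun [set: Omega] (low S).
  by move=> PS; apply: measurable_fun_einfs => n; exact/mPhi/PS.
have ilow S : inPhi S -> P.-integrable setT (EFin \o (@contract R \o low S)).
  move=> PS; apply: measurable_bounded_integrable => //.
  - by rewrite (le_lt_trans (probability_le1 _ _)) // ltry.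
  - exact/measurable_contract/mlow.
  - exists 1; split => // x x1 w _ /=.
    by rewrite (le_trans (contract_le1 _)) // ltW.
have JfinP S : inPhi S -> J S \is a fin_num.
  by move=> /ilow; exact: integrable_fin_num.
have leJ S S' : inPhi S -> inPhi S' -> (forall w, (low S w <= low S' w)%E) ->
    (J S <= J S')%E.
  move=> PS PS' SS'; apply: le_integral => //; [exact: ilow|exact: ilow|].
  by move=> w _; rewrite lee_fin le_contract.
pose a := ereal_inf [set J S | S in inPhi].
have a_le S : inPhi S -> (a <= J S)%E.
  by move=> PS; apply: ereal_inf_lbound; exists S.
have a_fin : a \is a fin_num.
  rewrite fin_numElt; apply/andP; split; last first.
    have PS : inPhi (fun=> X1) by move=> n.
    rewrite (le_lt_trans (a_le _ PS)) //.
    by have := JfinP _ PS; rewrite fin_numElt => /andP[].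
  rewrite (@lt_le_trans _ _ (-1%:E)%E) ?ltNyr //.
  apply: le_ereal_inf_tmp => _ [S PS <-].
  have -> : (- 1%:E = \int[P]_(w in setT) (cst (-1%R)%:E) w)%E.
    by rewrite integral_cst //= [X in (_ * X)%E]probability_setT mule1 EFinN.
  apply: le_integral => //; last 2 first.
  - exact: ilow.
  - move=> w _; rewrite lee_fin /=.
    by have := contract_le1 (low S w); rewrite ler_norml => /andP[].
  exact: finite_measure_integrable_cst.
have /choice[T HT] : forall k : nat, exists S,
    inPhi S /\ (J S < a + (k.+1%:R^-1)%:E)%E.
  move=> k; have k0 : 0 < k.+1%:R^-1 :> R by rewrite invr_gt0.
  by have [_ [S PS <-] ?] := lb_ereal_inf_adherent k0 a_fin; exists S.
pose U n := let p := odflt (0, 0)%N (unpickle n) in T p.1 p.2.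
have PU : inPhi U by move=> n; rewrite /U; apply: (HT _).1.
have UT k w : (low U w <= low (T k) w)%E.
  apply: lowG => n; have := lowE U (pickle (k, n)) w.
  by rewrite /U pickleK.
have JU : (J U <= a)%E.
  apply/lee_addgt0Pr => e e0.
  have [k ke] : exists k : nat, k.+1%:R^-1 < e.
    have [k _ /(_ _ (leqnn k)) ke] := near_infty_natSinv_lt (PosNum e0).
    by exists k.
  apply: (le_trans (leJ _ _ PU (HT k).1 (UT k))).
  by apply: (le_trans (ltW (HT k).2)); rewrite leeD2l // lee_fin ltW.
exists (low U); split; [exact: mlow| |]; last first.
  move=> Y mY YPhi.
  have /ae_foralln : forall n, \forall w \ae P, (Y w <= U n w)%E.
    by move=> n; exact/YPhi/PU.
  by apply: filterS => w YU; exact: lowG.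
move=> X PX.
pose U' n := if n is n'.+1 then U n' else X.
have PU' : inPhi U' by case.
have U'U w : (low U' w <= low U w)%E.
  by apply: lowG => n; exact: (lowE U' n.+1).
have JJ : J U = J U'.
  by apply/eqP; rewrite eq_le (le_trans JU (a_le _ PU')) leJ.
pose h w := ((@contract R (low U w))%:E - (@contract R (low U' w))%:E)%E.
have mh : measurable_fun [set: Omega] h.
  by apply: emeasurable_funB; apply/measurable_EFinP/measurable_contract/mlow.
have : (\int[P]_w `|h w| = 0)%E.
  transitivity (\int[P]_w h w)%E.
    apply: eq_integral => w _; rewrite gee0_abs // sube_ge0 ?fin_numE //.
    by rewrite lee_fin le_contract.
  rewrite integralB_EFin //; [|exact: ilow|exact: ilow].
  by rewrite -/(J U) -/(J U') JJ subee // JfinP.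
move/(ae_eq_integral_abs P measurableT mh).
apply: filterS => w /(_ I) /= /eqP; rewrite /h -EFinB eqe subr_eq0 => /eqP.
by move=> /contract_inj ->; exact: (lowE U' 0%N).
Qed.

Section Aggregation.
Variable rho : nat -> (Omega -> R) -> (Omega -> R).

(* [agg_rec n s W] is the nested evaluation of W_s, ..., W_(s + n). *)
Fixpoint agg_rec (n s : nat) (W : nat -> Omega -> R) : Omega -> R :=
  if n is n'.+1 then rho s (W s \+ agg_rec n' s.+1 W) else rho s (W s).

(* rho_{s,t}(W_s, ..., W_t); only meaningful for s <= t. *)
Definition agg_risk (s t : nat) (W : nat -> Omega -> R) : Omega -> R :=
  agg_rec (t - s) s W.

Definition agg_risk_infty (s : nat) (W : nat -> Omega -> R) : Omega -> \bar R :=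
  fun w => limn_esup (fun t => (agg_risk s t W w)%:E).

Lemma agg_risk_refl t W : agg_risk t t W = rho t (W t).
Proof. by rewrite /agg_risk subnn. Qed.

Lemma agg_risk_lt s t W : (s < t)%N ->
  agg_risk s t W = rho s (W s \+ agg_risk s.+1 t W).
Proof. by move=> st; rewrite /agg_risk -(subnSK st). Qed.

End Aggregation.

(* xi_(-1) is [initial_mode xi] and xi_t, for t >= 0, is [mode xi t]. *)
Record strategy (m : nat) := Strategy {
  initial_mode : 'I_m ;
  mode :> nat -> Omega -> 'I_m }.

(* xi_(t-1) *)
Definition mode_before (m : nat) (xi : strategy m) (t : nat) : Omega -> 'I_m :=
  if t is s.+1 then mode xi s else cst (initial_mode xi).

Definition adapted (G : nat -> set (set Omega)) (m : nat) (xi : strategy m)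
    : Prop :=
  forall t j, G t (mode xi t @^-1` [set j]).

(* U_t^i *)
Definition strategies_from (G : nat -> set (set Omega)) (m : nat)
    (t : nat) (i : 'I_m) : set (strategy m) :=
  [set xi | adapted G xi /\ \forall w \ae P, mode_before xi t w = i].

Section Switching.
Variables (G : nat -> set (set Omega)).
Variable rho : nat -> (Omega -> R) -> (Omega -> R).
Variable m : nat.
Variable g : 'I_m -> nat -> Omega -> R.
Variable c : 'I_m -> 'I_m -> nat -> Omega -> R.

Definition gtilde (i j : 'I_m) (t : nat) : Omega -> R := g j t \+ c i j t.

Definition strategy_cost (xi : strategy m) : nat -> Omega -> R :=
  fun s w => gtilde (mode_before xi s w) (xi s w) s w.

Definition value_process (t : nat) (i : 'I_m) : Omega -> \bar R :=
  ess_infimum [set agg_risk_infty rho t (strategy_cost xi)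
              | xi in strategies_from G t i].

(* [n] is the number of remaining steps.  The running cost sequence in the base
   case starts at time t.  The aggregated risk there is finite almost surely
   for the problems considered, so that [fine] only changes it on a null set.
   The big minimum is taken over a nonempty set, with the value at [i] as its
   default, so it is the minimum over all modes. *)
Fixpoint Vhat_rec (n t : nat) (i : 'I_m) : Omega -> R :=
  if n is n'.+1 then
    let F j := rho t (gtilde i j t \+ Vhat_rec n' t.+1 j) in
    fun w => \big[Order.min/F i w]_(j < m) F j w
  else fine \o agg_risk_infty rho t (g i).

Definition Vhat (t r : nat) (i : 'I_m) : Omega -> R := Vhat_rec (r.+1 - t) t i.

Lemma Vhat_gt t r i : (r < t)%N ->
  Vhat t r i = fine \o agg_risk_infty rho t (g i).
Proof. by rewrite /Vhat -subn_eq0 => /eqP ->. Qed.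

Lemma Vhat_le t r i : (t <= r)%N ->
  let F j := rho t (gtilde i j t \+ Vhat t.+1 r j) in
  Vhat t r i = fun w => \big[Order.min/F i w]_(j < m) F j w.
Proof. by move=> tr; rewrite /Vhat subSn. Qed.

(* rho_s(gtilde_{eta,j}(s) + X) for a random index eta *)
Definition risk_at (s : nat) (eta : Omega -> 'I_m) (j : 'I_m) (X : Omega -> R)
    : Omega -> R :=
  fun w => \sum_(k < m) \1_(eta @^-1` [set k]) w * rho s (gtilde k j s \+ X) w.

Definition argmin (F : 'I_m -> R) : set 'I_m :=
  [set j | forall k, F j <= F k].

(* xi is a strategy generated from (t, i) by the family V. *)
Definition greedy_strategy (V : nat -> 'I_m -> Omega -> R) (t : nat) (i : 'I_m)
    (xi : strategy m) : Prop :=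
  [/\ adapted G xi,
      initial_mode xi = i,
      forall r, (r < t)%N -> \forall w \ae P, xi r w = i
    & forall r, (t <= r)%N -> \forall w \ae P,
        argmin (fun j => risk_at r (mode_before xi r) j (V r.+1 j) w) (xi r w)].

Definition optimal_strategy (t : nat) (i : 'I_m) (xi : strategy m) : Prop :=
  strategies_from G t i xi /\
  \forall w \ae P,
    agg_risk_infty rho t (strategy_cost xi) w = value_process t i w.

End Switching.

End ConditionalRisk.

(* Main.v *)
(** Monotonicity and conditional translation invariance make each [rho_t]
   1-Lipschitz for the essential supremum norm and local on events of [G_t].
   With [K_t] the tail sums of the bounds [k_t], the finite-horizon values are
   then Cauchy, [|Vhat_(t,r) - Vhat_(t,r')| <= 2 K_r], and the limits satisfy the
   Bellman equation.  Locality evaluates this equation along a strategy: there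
   [Y_s = Vtilde_s(xi_(s-1))] satisfies [Y_s <= rho_s(cost_s + Y_(s+1))], with
   equality for greedy strategies.  Iterating up to time [r] and discarding the
   last term, which is at most [K_r], compares [Y_t] with the aggregated cost. *)

Require Import Defs.
From HB Require Import structures.
From mathcomp Require Import all_boot all_order all_algebra.
From mathcomp Require Import all_classical all_reals all_analysis.
From mathcomp Require Import measurable_realfun ring lra.

Set Implicit Arguments.
Unset Strict Implicit.
Unset Printing Implicit Defensive.

Import Order.TTheory GRing.Theory Num.Theory.
Import numFieldNormedType.Exports.

Local Open Scope classical_set_scope.
Local Open Scope ring_scope.

(** * Real sequences with a vanishing error, tail sums and finite minima *)

Section RealSequences.
Context (R : realType).

Lemma cvg0_le (x y : R) (e : nat -> R) (N : nat) :
  e @ \oo --> (0 : R) -> (forall n, (N <= n)%N -> x <= y + e n) -> x <= y.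
Proof.
move=> e0 xy; have ye : (fun n => y + e n) @ \oo --> y.
  by rewrite -[X in _ --> X]addr0; apply: cvgD => //; exact: cvg_cst.
rewrite -(cvg_lim _ ye) //; apply: limr_ge; first by apply/cvg_ex; exists y.
by exists N => // n /= Nn; exact: xy.
Qed.

Lemma cvg0_eq (x y : R) (e : nat -> R) (N : nat) :
  e @ \oo --> (0 : R) -> (forall n, (N <= n)%N -> `|x - y| <= e n) -> x = y.
Proof.
move=> e0 xy; apply/eqP; rewrite eq_le.
apply/andP; split; apply: (cvg0_le e0) => n /xy; rewrite ler_distl => /andP[] //.
by rewrite lerBlDr.
Qed.

(** Completeness gives a limit, with which the limsup coincides; letting [n'] tend to infinity in
    the Cauchy estimate keeps [e n] as the rate of convergence. *)
Lemma limn_esup_cauchy (u e : nat -> R) : e @ \oo --> (0 : R) ->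
    (forall n n', (n <= n')%N -> `|u n - u n'| <= e n) ->
  [/\ u @ \oo --> fine (limn_esup (EFin \o u)),
      limn_esup (EFin \o u) = (fine (limn_esup (EFin \o u)))%:E &
      forall n, `|u n - fine (limn_esup (EFin \o u))| <= e n].
Proof.
move=> e0 ue; have /cvg_ex[l ul] : cvgn u.
  apply/cauchy_cvgP/cauchy_exP => r r0.
  move/cvgr0Pnorm_lt : e0 => /(_ r r0)[N _ eN].
  exists (u N); exists N => // n /= Nn.
  apply: (le_lt_trans (ue _ _ Nn)).
  by apply: (le_lt_trans (ler_norm _)); apply: eN => /=.
have uE : limn_esup (EFin \o u) = l%:E.
  by apply: (cvg_limn_einf_sup _).2; exact/cvg_EFin/ul/nearW.
rewrite uE /=; split => // n.
have unl : (fun k => `|u n - u k|) @ \oo --> `|u n - l|.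
  by apply: cvg_norm; apply: cvgB => //; exact: cvg_cst.
rewrite -(cvg_lim _ unl) //; apply: limr_le; first by apply/cvg_ex; eexists; exact: unl.
by exists n => // k /= nk; exact: ue.
Qed.

Lemma summable_tail (k : nat -> R) : (forall t, 0 <= k t) -> cvgn (series k) ->
  exists K : nat -> R,
    [/\ forall t, 0 <= K t, forall t, k t + K t.+1 = K t & K @ \oo --> (0 : R)].
Proof.
(* [series k t] sums the indices below [t], so the tail [l - series k t] starts with [k t]. *)
move=> k0 /cvg_ex[l kl]; exists (fun t => l - series k t); split => [t|t|].
- rewrite subr_ge0 -(cvg_lim _ kl) //.
  apply: nondecreasing_cvgn_le; last by apply/cvg_ex; exists l.
  by apply/nondecreasing_seqP => n; rewrite seriesSr lerDl.
- by rewrite seriesSr; ring.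
- by rewrite -(subrr l); apply: cvgB => //; exact: cvg_cst.
Qed.

Section FiniteMinimum.
Variable m : nat.
Implicit Types (F : 'I_m -> R) (i j : 'I_m).

(** The default [F i] is itself one of the values. The form is that of the minimum in [Vhat_rec], so
    that the two are convertible. *)
Definition minR F i : R := \big[Order.min/F i]_(j < m) F j.

Lemma minR_le F i j : minR F i <= F j.
Proof. exact: bigmin_le. Qed.

Lemma le_minR F i x : (forall j, x <= F j) -> x <= minR F i.
Proof. by move=> xF; apply: le_bigmin. Qed.

Lemma minR_argmin F i j : argmin F j -> minR F i = F j.
Proof.
by move=> jF; apply/eqP; rewrite eq_le minR_le le_minR.
Qed.

Lemma minR_dist F F' i (e : R) :
  (forall j, `|F j - F' j| <= e) -> `|minR F i - minR F' i| <= e.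
Proof.
move=> FF'; have le_ F1 F2 : (forall j, `|F1 j - F2 j| <= e) ->
    minR F1 i <= minR F2 i + e.
  move=> F12; rewrite -lerBlDr; apply: le_minR => j; rewrite lerBlDr.
  apply: (le_trans (minR_le _ _ j)).
  by have := F12 j; rewrite ler_distl => /andP[_].
rewrite ler_distl lerBlDr !le_ // => j; by rewrite distrC.
Qed.

End FiniteMinimum.

End RealSequences.

(** * Measurable maps into finite types and measurable choice of a minimiser *)

Section FiniteValuedFunctions.
Context (d : measure_display) (T : measurableType d).

Lemma measurable_preimage_fin (I : finType) (f : T -> I) :
  (forall i, measurable (f @^-1` [set i])) -> forall A, measurable (f @^-1` A).
Proof.
move=> mf A; rewrite (_ : f @^-1` A = \bigcup_(i in A) f @^-1` [set i]).
  by apply: fin_bigcup_measurable => // i _; exact: mf.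
by apply/seteqP; split => w /=; [exists (f w)|case=> i Ai /= ->].
Qed.

Lemma measurable_preimage_select (I J : finType) (eta : T -> I)
    (f : I -> T -> J) :
    (forall i, measurable (eta @^-1` [set i])) ->
    (forall i j, measurable (f i @^-1` [set j])) ->
  forall j, measurable ((fun w => f (eta w) w) @^-1` [set j]).
Proof.
move=> meta mf j; rewrite (_ : _ @^-1` _ =
    \bigcup_(i in setT) (eta @^-1` [set i] `&` f i @^-1` [set j])).
  apply: fin_bigcup_measurable => // i _.
  by apply: measurableI; [exact: meta|exact: mf].
by apply/seteqP; split => w /=; [exists (eta w)|case=> i _ /= [->]].
Qed.

Lemma measurable_preimage_pair (I J : finType) (f : T -> I) (h : T -> J) :
    (forall i, measurable (f @^-1` [set i])) ->
    (forall j, measurable (h @^-1` [set j])) ->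
  forall p, measurable ((fun w => (f w, h w)) @^-1` [set p]).
Proof.
move=> mf mh [i j]; rewrite (_ : _ @^-1` _ = f @^-1` [set i] `&` h @^-1` [set j]).
  by apply: measurableI; [exact: mf|exact: mh].
by apply/seteqP; split => w /= [-> ->].
Qed.

Context (R : realType) (m : nat).

(** [pick] follows the fixed enumeration of the modes, which settles ties deterministically. A
    minimiser always exists, so the fallback on [i] is never taken. *)
Definition first_argmin (F : 'I_m -> R) (i : 'I_m) : 'I_m :=
  odflt i [pick j | [forall l, F j <= F l]].

Lemma first_argminP (F : 'I_m -> R) (i : 'I_m) : argmin F (first_argmin F i).
Proof.
rewrite /first_argmin; case: pickP => [j /forallP //|/=].
have [j _ jF] := @arg_minP _ _ _ i xpredT F isT.
by move=> /(_ j)/negP[]; apply/forallP => l; exact: jF.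
Qed.

(* [first_argmin] only depends on the finite table of comparisons. *)
Lemma measurable_first_argmin (F : 'I_m -> T -> R) (i : 'I_m) :
    (forall j, measurable_fun [set: T] (F j)) ->
  forall j, measurable ((fun w => first_argmin (F ^~ w) i) @^-1` [set j]).
Proof.
move=> mF j.
pose tab w := [ffun p : 'I_m * 'I_m => F p.1 w <= F p.2 w].
pose sel (b : {ffun 'I_m * 'I_m -> bool}) :=
  odflt i [pick j | [forall l, b (j, l)]].
have selE w : first_argmin (F ^~ w) i = sel (tab w).
  rewrite /first_argmin /sel; congr (odflt _ _); apply: eq_pick => a.
  by apply: eq_forallb => l; rewrite ffunE.
under eq_fun do rewrite selE.
apply: (@measurable_preimage_fin _ tab _ (sel @^-1` [set j])) => b.
rewrite (_ : _ @^-1` _ =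
    \bigcap_(p in setT) ((fun w => F p.1 w <= F p.2 w) @^-1` [set b p])).
  apply: fin_bigcap_measurable => // p _; rewrite -[X in measurable X]setTI.
  by apply: (measurable_fun_ler (mF p.1) (mF p.2)).
apply/seteqP; split => [w /= <- p _|w /= wb]; first by rewrite /= ffunE.
by apply/ffunP => p; rewrite ffunE; exact: wb.
Qed.

Lemma measurable_minR (F : 'I_m -> T -> R) (i : 'I_m) :
    (forall j, measurable_fun [set: T] (F j)) ->
  measurable_fun [set: T] (fun w => minR (F ^~ w) i).
Proof.
move=> mF; rewrite /minR.
elim: (index_enum _) => [|j s IH].
  by under eq_fun do rewrite big_nil; exact: mF.
under eq_fun do rewrite big_cons.
exact: (measurable_minr (mF j) IH).
Qed.

End FiniteValuedFunctions.

(** * Essentially bounded functions and pointwise limits superior *)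

Section EssentiallyBounded.
Context (R : realType) (d : measure_display) (Omega : measurableType d).
Variable P : probability Omega R.
Local Notation L := (Lfun P +oo).

Lemma LfunooP (X : Omega -> R) : X \in L <->
  measurable_fun [set: Omega] X /\
  exists M : R, \forall w \ae P, `|X w| <= M.
Proof.
(* [Lnorm] at exponent [+oo] is the essential supremum only when the total mass is positive. *)
have P0 : (0 < P [set: Omega])%E by rewrite probability_setT.
rewrite inE /Lfun /= /finLfun; split=> [/andP[]|[mX [M XM]]].
  rewrite !inE /= /finite_norm unlock /Lnorm P0 => mX Xoo; split => //.
  have : (ess_sup_inf.ess_sup P (abse \o EFin \o X) <=
      (fine (ess_sup_inf.ess_sup P (abse \o EFin \o X)))%:E)%E.
    rewrite fineK // fin_numElt Xoo andbT.
    rewrite (@lt_le_trans _ _ 0%E) ?ltNy0 //.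
    by apply: ess_sup_inf.ess_sup_gee => //; apply: aeW => w; exact: abse_ge0.
  move/ess_sup_inf.ess_supP => H; eexists; move: H; apply: filterS => w.
  by rewrite /= lee_fin; exact.
apply/andP; split; rewrite inE //= /finite_norm unlock /Lnorm P0.
apply: (@le_lt_trans _ _ M%:E); last exact: ltry.
apply/ess_sup_inf.ess_supP; apply: filterS XM => w.
by rewrite /= lee_fin.
Qed.

Lemma LfunooD (X Y : Omega -> R) : X \in L -> Y \in L -> X \+ Y \in L.
Proof.
move=> /LfunooP[mX [M XM]] /LfunooP[mY [N YN]]; apply/LfunooP; split.
  exact: measurable_funD.
exists (M + N); apply: filterS2 XM YN => w XM YN /=.
by apply: (le_trans (ler_normD _ _)); exact: lerD.
Qed.

Lemma Lfunoo_cst (a : R) : cst a \in L.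
Proof.
by apply/LfunooP; split; [exact: measurable_cst|exists `|a|; exact: aeW].
Qed.

Lemma Lfunoo_select (I : finType) (eta : Omega -> I) (X : I -> Omega -> R) :
  (forall i, measurable (eta @^-1` [set i])) -> (forall i, X i \in L) ->
  (fun w => X (eta w) w) \in L.
Proof.
move=> meta LX.
(* Indicators of the fibres of [eta] turn the random index into a finite sum, which can be treated
   term by term. *)
have -> : (fun w => X (eta w) w) =
    (fun w => \sum_i \1_(eta @^-1` [set i]) w * X i w).
  apply/funext => w; rewrite (bigD1 (eta w)) //= big1 => [|i iw].
    by rewrite indicE mem_set //= mul1r addr0.
  by rewrite indicE memNset ?mul0r // => /= iE; rewrite iE eqxx in iw.
apply/LfunooP; split.
  apply: measurable_sum => i; apply: measurable_funM.
    exact: measurable_indic.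
  by have /LfunooP[] := LX i.
have /choice[M XM] : forall i, exists M, \forall w \ae P, `|X i w| <= M.
  by move=> i; have /LfunooP[] := LX i.
(* Absolute values make the bounds nonnegative, so that they also dominate the terms whose indicator
   vanishes. *)
exists (\sum_i `|M i|).
have : \forall w \ae P, forall i, `|X i w| <= M i by exact: filter_forall.
apply: filterS => w XMw; apply: (le_trans (ler_norm_sum _ _ _)).
apply: ler_sum => i _; rewrite normrM indicE.
case: (_ \in _); rewrite ?normr0 ?mul0r ?normr1 ?mul1r //.
by apply: (le_trans (XMw i)); exact: ler_norm.
Qed.

(** The limsup is defined at every point, so it inherits measurability from [u] even for a
    sub-sigma-algebra that lacks the null sets; an arbitrary version of the almost sure limit might
    not. *)
Definition flimsup (u : nat -> Omega -> R) : Omega -> R :=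
  fun w => fine (limn_esup (fun n => (u n w)%:E)).

(** The null sets of the countably many pairs [(n, n')] are united first; off their union the
    deterministic statement applies pointwise. *)
Lemma ae_flimsup (u : nat -> Omega -> R) (e : nat -> R) :
    e @ \oo --> (0 : R) ->
    (forall n n', (n <= n')%N -> \forall w \ae P, `|u n w - u n' w| <= e n) ->
  \forall w \ae P, [/\ u ^~ w @ \oo --> flimsup u w,
    limn_esup (fun n => (u n w)%:E) = (flimsup u w)%:E &
    forall n, `|u n w - flimsup u w| <= e n].
Proof.
move=> e0 ue; have : \forall w \ae P, forall n n', (n <= n')%N ->
    `|u n w - u n' w| <= e n.
  apply: ae_foralln => n; apply: ae_foralln => n'.
  have [nn'|nn'] := boolP (n <= n')%N.
    by apply: filterS (ue _ _ nn') => w.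
  by apply: aeW => w.
by apply: filterS => w uew; exact: limn_esup_cauchy.
Qed.

Lemma flimsup_measurable (H : set (set Omega)) (u : nat -> Omega -> R) :
  (forall n, measurable_fun [set: g_sigma_algebraType H]
     (u n : g_sigma_algebraType H -> R)) ->
  measurable_fun [set: g_sigma_algebraType H]
     (flimsup u : g_sigma_algebraType H -> R).
Proof.
move=> mu; apply: (@measurableT_comp _ _ _ _ _ _ fine).
  exact: fine_measurable.
apply: measurable_fun_limn_esup => n.
exact/measurable_EFinP.
Qed.

End EssentiallyBounded.

(** * One-step estimates for a conditional risk mapping: Lipschitz bound and locality *)

Section ConditionalRiskMapping.
Context (R : realType) (d : measure_display) (Omega : measurableType d).
Variables (P : probability Omega R) (G : nat -> set (set Omega)).
Variable rho : nat -> (Omega -> R) -> (Omega -> R).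
Hypotheses (hG : filtration G) (hrho : conditional_risk_mapping P G rho).
Local Notation L := (Lfun P +oo).

Lemma filtration_measurableE t :
  (@measurable _ (g_sigma_algebraType (G t))) = G t.
Proof. by case: hG => sG _ _; exact: measurable_g_measurableTypeE. Qed.

Lemma filtration_measurable t A : G t A -> measurable A.
Proof. by case: hG => _ GF _; exact: GF. Qed.

Lemma Linfty_Lfun t X : Linfty P (G t) X -> X \in L.
Proof. by case. Qed.

Lemma Linfty_scaled_indic t A (M : R) : G t A ->
  Linfty P (G t) (fun w => M * \1_A w).
Proof.
move=> GA; split.
  apply/LfunooP; split.
    apply: measurable_funM => //; apply: measurable_indic.
    exact: filtration_measurable GA.
  exists `|M|; apply: aeW => w; rewrite normrM indicE.
  by case: (_ \in _); rewrite ?normr0 ?mulr0 ?normr1 ?mulr1.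
apply: measurable_funM => //; apply: measurable_indic.
by rewrite filtration_measurableE.
Qed.

Lemma Linfty_cst t (a : R) : Linfty P (G t) (cst a).
Proof. by split; [exact: Lfunoo_cst|exact: measurable_cst]. Qed.

(** Constants are measurable for every [G t], so translation invariance moves [e] out of [rho t];
    monotonicity does the rest. *)
Lemma rho_le_cst t W Z (e : R) : W \in L -> Z \in L ->
    (\forall w \ae P, W w <= Z w + e) ->
  \forall w \ae P, rho t W w <= rho t Z w + e.
Proof.
move=> LW LZ WZ.
have WZ' : \forall w \ae P, W w <= (cst e \+ Z) w.
  by apply: filterS WZ => w; rewrite /= addrC.
have := crm_le hrho t LW (LfunooD (Lfunoo_cst P e) LZ) WZ'.
have := crm_translation hrho (Linfty_cst t e) LZ.
by apply: filterS2 => w -> /=; rewrite addrC.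
Qed.

Lemma rho_dist t W Z (e : R) : W \in L -> Z \in L ->
    (\forall w \ae P, `|W w - Z w| <= e) ->
  \forall w \ae P, `|rho t W w - rho t Z w| <= e.
Proof.
move=> LW LZ WZ.
have /(rho_le_cst t LW LZ) : \forall w \ae P, W w <= Z w + e.
  by apply: filterS WZ => w; rewrite ler_distl => /andP[].
have /(rho_le_cst t LZ LW) : \forall w \ae P, Z w <= W w + e.
  by apply: filterS WZ => w; rewrite ler_distl lerBlDr => /andP[].
by apply: filterS2 => w; rewrite ler_distl lerBlDr => -> ->.
Qed.

(** By normalisation this is the Lipschitz estimate against the zero function. *)
Lemma rho_bound t W (e : R) : W \in L ->
    (\forall w \ae P, `|W w| <= e) -> \forall w \ae P, `|rho t W w| <= e.
Proof.
move=> LW We; have We0 : \forall w \ae P, `|W w - cst 0 w| <= e.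
  by apply: filterS We => w; rewrite subr0.
have := rho_dist t LW (Lfunoo_cst P 0) We0.
by apply: filterS2 (crm_normalised hrho t) => w ->; rewrite subr0.
Qed.

(* If W = Z on A then W <= Z + M 1_(~A) for a constant M, and the last term can
   be taken out of [rho] because A is G_t-measurable. *)
Lemma rho_local_le t A W Z : G t A -> W \in L -> Z \in L ->
    (\forall w \ae P, A w -> W w = Z w) ->
  \forall w \ae P, A w -> rho t W w <= rho t Z w.
Proof.
move=> GA LW LZ WZ.
have /LfunooP[_ [M WM]] := LW; have /LfunooP[_ [N ZN]] := LZ.
have GCA : G t (~` A).
  by case: hG => /(_ t)[_ GC _] _ _; rewrite -setTD; exact: GC.
have LI := Linfty_scaled_indic (M + N) GCA.
have le_ : \forall w \ae P,
    W w <= ((fun w => (M + N) * \1_(~` A) w) \+ Z) w.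
  apply: filterS3 WZ WM ZN => w WZ WM ZN /=; rewrite indicE.
  have [Aw|Aw] := pselect (A w).
    by rewrite memNset ?mulr0 ?add0r ?WZ //= => /(_ Aw).
  rewrite mem_set //= mulr1; move: WM ZN; rewrite !ler_norml.
  by move=> /andP[_ WM] /andP[ZN _]; lra.
have := crm_le hrho t LW (LfunooD (Linfty_Lfun LI) LZ) le_.
have := crm_translation hrho LI LZ.
apply: filterS2 => w -> /[swap] Aw.
by rewrite indicE memNset ?mulr0 ?add0r // => /(_ Aw).
Qed.

(** On each fibre of [eta], an event of [G t], the pasted variable agrees with [X i], and locality
    in both directions identifies the risks. A random index known at time [t] may thus be frozen
    inside [rho t]. *)
Lemma rho_select t (I : finType) (eta : Omega -> I) (X : I -> Omega -> R) :
    (forall i, G t (eta @^-1` [set i])) -> (forall i, X i \in L) ->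
  \forall w \ae P, rho t (fun w => X (eta w) w) w = rho t (X (eta w)) w.
Proof.
move=> Geta LX.
have Lsel : (fun w => X (eta w) w) \in L.
  by apply: Lfunoo_select => // i; exact: filtration_measurable (Geta i).
suff : \forall w \ae P, forall i, (eta @^-1` [set i]) w ->
    rho t (fun w => X (eta w) w) w = rho t (X i) w.
  by apply: filterS => w; exact.
apply: filter_forall => i.
have XE : \forall w \ae P, (eta @^-1` [set i]) w -> X (eta w) w = X i w.
  by apply: aeW => w /= ->.
have EX : \forall w \ae P, (eta @^-1` [set i]) w -> X i w = X (eta w) w.
  by apply: aeW => w /= ->.
have := rho_local_le (Geta i) Lsel (LX i) XE.
have := rho_local_le (Geta i) (LX i) Lsel EX.
apply: filterS2 => w le1 le2 etaw.
by apply/eqP; rewrite eq_le le1 ?le2.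
Qed.

(** * Aggregated risk of a summably bounded sequence *)

Section Aggregation.
Variables (W : nat -> Omega -> R) (k K : nat -> R).
Hypotheses (LW : forall s, W s \in L)
  (Wk : forall s, \forall w \ae P, `|W s w| <= k s)
  (k0 : forall s, 0 <= k s) (K0 : forall s, 0 <= K s)
  (kK : forall s, k s + K s.+1 = K s) (Kcvg : K @ \oo --> (0 : R)).

Lemma tail_nonincreasing s t : (s <= t)%N -> K t <= K s.
Proof.
move=> st; rewrite -(subnKC st); elim: (t - s)%N => [|n IH]; first by rewrite addn0.
by apply: le_trans IH; rewrite addnS -[leRHS]kK lerDr.
Qed.

Lemma agg_rec_Linfty n s : Linfty P (G s) (agg_rec rho n s W).
Proof.
elim: n s => [|n IH] s /=; first exact: crm_range.
by apply: crm_range => //; apply: LfunooD => //; exact: Linfty_Lfun (IH _).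
Qed.

(** The bounds add up backwards in time: the argument of [rho s] is bounded by [k s + K s.+1 = K s],
    and [rho s] preserves this bound. *)
Lemma agg_rec_bound n s : \forall w \ae P, `|agg_rec rho n s W w| <= K s.
Proof.
elim: n s => [|n IH] s /=; apply: rho_bound => //.
- by apply: filterS (Wk s) => w Wkw; rewrite -kK (le_trans Wkw) // lerDl.
- by apply: LfunooD => //; exact: Linfty_Lfun (agg_rec_Linfty _ _).
- apply: filterS2 (Wk s) (IH s.+1) => w Wkw aK /=.
  by rewrite -kK (le_trans (ler_normD _ _)) // lerD.
Qed.

(** The two nested evaluations share their outer layers. Each layer is 1-Lipschitz, so only the
    additional inner part counts, which starts at time [s + n + 1]. *)
Lemma agg_rec_dist n n' s : (n <= n')%N ->
  \forall w \ae P, `|agg_rec rho n s W w - agg_rec rho n' s W w| <= K (s + n)%N.+1.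
Proof.
elim: n n' s => [|n IH] [|n'] s // nn'.
- by apply: aeW => w; rewrite subrr normr0.
- rewrite addn0; apply: rho_dist => //.
    by apply: LfunooD => //; exact: Linfty_Lfun (agg_rec_Linfty _ _).
  apply: filterS (agg_rec_bound n' s.+1) => w.
  by rewrite /= opprD addrA subrr sub0r normrN.
- rewrite -addSnnS; apply: rho_dist;
    try by apply: LfunooD => //; exact: Linfty_Lfun (agg_rec_Linfty _ _).
  apply: filterS (IH n' s.+1 nn') => w.
  by rewrite /= opprD addrACA subrr add0r.
Qed.

Lemma agg_risk_dist s t t' : (t <= t')%N ->
  \forall w \ae P, `|agg_risk rho s t W w - agg_risk rho s t' W w| <= K t.
Proof.
move=> tt'; apply: filterS (agg_rec_dist s (leq_sub2r s tt')) => w /le_trans.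
(* Subtraction truncates, but [t <= s + (t - s) + 1] holds also for [t < s]; the estimate thus
   covers every [t], as [ae_flimsup] requires. *)
by apply; apply: tail_nonincreasing; rewrite leqW // -leq_subLR.
Qed.

Lemma agg_risk_infty_limit s : \forall w \ae P,
  agg_risk_infty rho s W w = (flimsup (agg_risk rho s ^~ W) w)%:E /\
  forall t, `|agg_risk rho s t W w - flimsup (agg_risk rho s ^~ W) w| <= K t.
Proof.
have := ae_flimsup Kcvg (@agg_risk_dist s).
by apply: filterS => w [_ aE aK]; split.
Qed.

Lemma agg_risk_infty_measurable s :
  measurable_fun [set: Omega] (agg_risk_infty rho s W).
Proof.
apply: measurable_fun_limn_esup => t; apply/measurable_EFinP.
by have /Linfty_Lfun/LfunooP[] := agg_rec_Linfty (t - s) s.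
Qed.

Lemma fine_agg_risk_infty_Linfty s :
  Linfty P (G s) (fine \o agg_risk_infty rho s W).
Proof.
have mG : measurable_fun [set: g_sigma_algebraType (G s)]
    (flimsup (agg_risk rho s ^~ W) : g_sigma_algebraType (G s) -> R).
  by apply: flimsup_measurable => t; case: (agg_rec_Linfty (t - s) s).
split => //; apply/LfunooP; split.
  apply: (@measurableT_comp _ _ _ _ _ _ fine); first exact: fine_measurable.
  exact: agg_risk_infty_measurable.
(* One [K 0] bounds the distance from the limit to the aggregate at [t = 0], the other that
   aggregate itself, through [K s <= K 0]. *)
exists (K 0%N + K 0%N).
apply: filterS2 (agg_risk_infty_limit s) (agg_rec_bound (0 - s) s).
move=> w [aE /(_ 0%N) aK] bK /=; rewrite aE /=.
rewrite -[X in `|X|](addrNK (agg_risk rho s 0 W w)).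
apply: (le_trans (ler_normD _ _)); rewrite lerD //; first by rewrite distrC.
by apply: (le_trans bK); exact: tail_nonincreasing.
Qed.

Lemma fine_agg_risk_infty_bound s :
  \forall w \ae P, `|fine (agg_risk_infty rho s W w)| <= K s.
Proof.
have : \forall w \ae P, forall t, `|agg_risk rho s t W w| <= K s.
  by apply: ae_foralln => t; exact: agg_rec_bound.
apply: filterS2 (agg_risk_infty_limit s) => w [-> aK] bK /=.
(* The triangle inequality through the aggregate up to time [n] gives [K s + K n]; letting [n] grow
   leaves [K s]. *)
apply: (cvg0_le (N := 0) Kcvg) => n _.
rewrite -[X in `|X|](addrNK (agg_risk rho s n W w)).
apply: (le_trans (ler_normD _ _)); rewrite addrC lerD //.
by rewrite distrC.
Qed.

(** * Verification: one-step inequalities compared with the infinite-horizon risk *)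

Section Verification.
Variables (Y : nat -> Omega -> R) (t : nat).
Hypotheses (LY : forall s, Y s \in L)
  (YK : forall s, \forall w \ae P, `|Y s w| <= K s).

(** After unrolling, the innermost argument still contains [Y (s + n + 1)]. It is at most
    [K (s + n + 1)], and this constant passes through all layers of [rho] to the outside. *)
Lemma verification_le :
    (forall s, (t <= s)%N ->
       \forall w \ae P, Y s w <= rho s (W s \+ Y s.+1) w) ->
  \forall w \ae P, ((Y t w)%:E <= agg_risk_infty rho t W w)%E.
Proof.
move=> Yle.
have Yagg n s : (t <= s)%N ->
    \forall w \ae P, Y s w <= agg_rec rho n s W w + K (s + n)%N.+1.
  elim: n s => [|n IH] s ts.
    have /(rho_le_cst s (LfunooD (LW s) (LY s.+1)) (LW s)) :
        \forall w \ae P, (W s \+ Y s.+1) w <= W s w + K s.+1.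
      by apply: filterS (YK s.+1) => w; rewrite ler_norml lerD2l => /andP[].
    by apply: filterS2 (Yle _ ts) => w; rewrite addn0; exact: le_trans.
  have LA := Linfty_Lfun (agg_rec_Linfty n s.+1).
  have /(rho_le_cst s (LfunooD (LW s) (LY s.+1)) (LfunooD (LW s) LA)) :
      \forall w \ae P, (W s \+ Y s.+1) w <=
        (W s \+ agg_rec rho n s.+1 W) w + K (s.+1 + n)%N.+1.
    by apply: filterS (IH s.+1 (leqW ts)) => w; rewrite /= -addrA lerD2l.
  by apply: filterS2 (Yle _ ts) => w; rewrite addSnnS; exact: le_trans.
have : \forall w \ae P, forall n, Y t w <= agg_rec rho n t W w + K (t + n)%N.+1.
  by apply: ae_foralln => n; exact: Yagg.
apply: filterS2 (agg_risk_infty_limit t) => w [-> aK] YA; rewrite lee_fin.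
(* One [K n] accounts for the discarded term, since [K n.+1 <= K n], the other for the distance
   between the aggregate up to time [n] and its limit. *)
apply: (@cvg0_le _ _ _ (fun n => K n + K n) t).
  by rewrite -(addr0 0); exact: cvgD.
move=> n tn; have := YA (n - t)%N; have := aK n.
rewrite subnKC // ler_distl => /andP[_ aK1] YA1.
have Kn : K n.+1 <= K n by exact: tail_nonincreasing.
by rewrite /agg_risk in aK1 *; lra.
Qed.

(** The unrolling is the same with the inequalities reversed; dropping the last [Y] now uses its
    lower bound. *)
Lemma verification_ge :
    (forall s, (t <= s)%N ->
       \forall w \ae P, rho s (W s \+ Y s.+1) w <= Y s w) ->
  \forall w \ae P, (agg_risk_infty rho t W w <= (Y t w)%:E)%E.
Proof.
move=> leY.
have aggY n s : (t <= s)%N ->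
    \forall w \ae P, agg_rec rho n s W w <= Y s w + K (s + n)%N.+1.
  elim: n s => [|n IH] s ts.
    have /(rho_le_cst s (LW s) (LfunooD (LW s) (LY s.+1))) :
        \forall w \ae P, W s w <= (W s \+ Y s.+1) w + K s.+1.
      apply: filterS (YK s.+1) => w; rewrite ler_norml => /andP[YK1 _].
      by rewrite /= -addrA lerDl -lerBlDr sub0r.
    apply: filterS2 (leY _ ts) => w leYw /le_trans; apply.
    by rewrite addn0 lerD2r.
  have LA := Linfty_Lfun (agg_rec_Linfty n s.+1).
  have /(rho_le_cst s (LfunooD (LW s) LA) (LfunooD (LW s) (LY s.+1))) :
      \forall w \ae P, (W s \+ agg_rec rho n s.+1 W) w <=
        (W s \+ Y s.+1) w + K (s.+1 + n)%N.+1.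
    by apply: filterS (IH s.+1 (leqW ts)) => w; rewrite /= -addrA lerD2l.
  apply: filterS2 (leY _ ts) => w leYw /le_trans; apply.
  by rewrite addSnnS lerD2r.
have : \forall w \ae P, forall n, agg_rec rho n t W w <= Y t w + K (t + n)%N.+1.
  by apply: ae_foralln => n; exact: aggY.
apply: filterS2 (agg_risk_infty_limit t) => w [-> aK] AY; rewrite lee_fin.
apply: (@cvg0_le _ _ _ (fun n => K n + K n) t).
  by rewrite -(addr0 0); exact: cvgD.
move=> n tn; have := AY (n - t)%N; have := aK n.
rewrite subnKC // ler_distl => /andP[aK1 _] AY1.
have Kn : K n.+1 <= K n by exact: tail_nonincreasing.
by rewrite /agg_risk in aK1 *; lra.
Qed.

End Verification.
End Aggregation.
End ConditionalRiskMapping.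

(** Only the summand of the actual index survives, at every point and not just almost surely. *)
Lemma risk_atE (R : realType) (d : measure_display) (Omega : measurableType d)
    (rho : nat -> (Omega -> R) -> (Omega -> R)) (m : nat)
    (g : 'I_m -> nat -> Omega -> R) (c : 'I_m -> 'I_m -> nat -> Omega -> R)
    s (eta : Omega -> 'I_m) j (X : Omega -> R) w :
  risk_at rho g c s eta j X w = rho s (gtilde g c (eta w) j s \+ X) w.
Proof.
rewrite /risk_at (bigD1 (eta w)) //= big1 => [|i iw].
  by rewrite indicE mem_set // mul1r addr0.
by rewrite indicE memNset ?mul0r // => /= iE; rewrite iE eqxx in iw.
Qed.

(** * Finite-horizon values, their limit and the Bellman equation *)

Section Switching.
Context (R : realType) (d : measure_display) (Omega : measurableType d).
Variables (P : probability Omega R) (G : nat -> set (set Omega)).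
Variable rho : nat -> (Omega -> R) -> (Omega -> R).
Hypotheses (hG : filtration G) (hrho : conditional_risk_mapping P G rho).
Variables (m : nat) (g : 'I_m -> nat -> Omega -> R)
  (c : 'I_m -> 'I_m -> nat -> Omega -> R).
Hypotheses (hg : forall i t, g i t \in Lfun P +oo)
  (hc : forall i j t, c i j t \in Lfun P +oo)
  (hc0 : forall i t, \forall w \ae P, c i i t w = 0).
Variables k K : nat -> R.
Hypotheses (k0 : forall s, 0 <= k s) (K0 : forall s, 0 <= K s)
  (kK : forall s, k s + K s.+1 = K s) (Kcvg : K @ \oo --> (0 : R))
  (gk : forall t i j, \forall w \ae P, `|gtilde g c i j t w| <= k t).
Local Notation L := (Lfun P +oo).

Lemma gtilde_Lfun i j t : gtilde g c i j t \in L.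
Proof. by apply: LfunooD. Qed.

(** Staying in a mode costs no switching, so the diagonal of [gtilde] is [g]. This controls the base
    case of [Vhat_rec]. *)
Lemma running_cost_bound i t : \forall w \ae P, `|g i t w| <= k t.
Proof.
by apply: filterS2 (hc0 i t) (gk t i i) => w; rewrite /gtilde /= => ->; rewrite addr0.
Qed.

Lemma minR_Linfty t (F : 'I_m -> Omega -> R) i :
  (forall j, Linfty P (G t) (F j)) -> Linfty P (G t) (fun w => minR (F ^~ w) i).
Proof.
move=> LF; split; last first.
  apply: (@measurable_minR _ (g_sigma_algebraType (G t)) R m F i) => j.
  by have [] := LF j.
(* Written as the value at a measurably chosen index, the minimum is essentially bounded by
   [Lfunoo_select]. *)
under eq_fun do rewrite (minR_argmin _ (first_argminP (F ^~ _) i)).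
apply: Lfunoo_select => j; last exact: Linfty_Lfun (LF j).
by apply: measurable_first_argmin => l; have /Linfty_Lfun/LfunooP[] := LF l.
Qed.

Lemma Vhat_rec_Linfty n t i : Linfty P (G t) (Vhat_rec rho g c n t i).
Proof.
elim: n t i => [|n IH] t i /=.
  exact: (fine_agg_risk_infty_Linfty hrho (hg i) (running_cost_bound i) k0 K0 kK Kcvg).
apply: (@minR_Linfty _ (fun j => rho t (gtilde g c i j t \+ _))) => j.
apply: (crm_range hrho); apply: LfunooD; first exact: gtilde_Lfun.
exact: Linfty_Lfun (IH _ _).
Qed.

Lemma continuation_Lfun t i j (X : Omega -> R) :
  X \in L -> gtilde g c i j t \+ X \in L.
Proof. exact/LfunooD/gtilde_Lfun. Qed.

Lemma Vhat_rec_bound n t i : \forall w \ae P, `|Vhat_rec rho g c n t i w| <= K t.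
Proof.
elim: n t i => [|n IH] t i /=.
  exact: (fine_agg_risk_infty_bound hrho (hg i) (running_cost_bound i) k0 K0 kK Kcvg).
have : \forall w \ae P, forall j,
    `|rho t (gtilde g c i j t \+ Vhat_rec rho g c n t.+1 j) w| <= K t.
  apply: filter_forall => j; apply: (rho_bound hrho).
    exact: continuation_Lfun (Linfty_Lfun (Vhat_rec_Linfty _ _ _)).
  apply: filterS2 (gk t i j) (IH t.+1 j) => w gw Vw /=.
  by rewrite -kK (le_trans (ler_normD _ _)) // lerD.
apply: filterS => w.
by rewrite -/(minR _ i) (minR_argmin _ (first_argminP _ i)); exact.
Qed.

(** Minimum and [rho] are 1-Lipschitz, so it suffices to compare at time [t + n], where the shorter
    recursion stops. There both values are bounded by [K (t + n)], hence the factor two. *)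
Lemma Vhat_rec_dist n n' t i : (n <= n')%N -> \forall w \ae P,
  `|Vhat_rec rho g c n t i w - Vhat_rec rho g c n' t i w|
     <= K (t + n)%N + K (t + n)%N.
Proof.
elim: n n' t i => [|n IH] n' t i nn'.
  apply: filterS2 (Vhat_rec_bound 0 t i) (Vhat_rec_bound n' t i) => w V0 Vn.
  by rewrite addn0 (le_trans (ler_normB _ _)) // lerD.
case: n' => // n' in nn' *; rewrite /= -addSnnS.
have : \forall w \ae P, forall j,
    `|rho t (gtilde g c i j t \+ Vhat_rec rho g c n t.+1 j) w -
      rho t (gtilde g c i j t \+ Vhat_rec rho g c n' t.+1 j) w| <=
    K (t.+1 + n)%N + K (t.+1 + n)%N.
  apply: filter_forall => j; apply: (rho_dist hrho);
    try exact: continuation_Lfun (Linfty_Lfun (Vhat_rec_Linfty _ _ _)).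
  apply: filterS (IH n' t.+1 j nn') => w.
  by rewrite /= opprD addrACA subrr add0r.
by apply: filterS => w; exact: minR_dist.
Qed.

Lemma Vhat_dist t r r' i : (r <= r')%N -> \forall w \ae P,
  `|Vhat rho g c t r i w - Vhat rho g c t r' i w| <= K r + K r.
Proof.
move=> rr'; have := Vhat_rec_dist t i (leq_sub2r t (rr' : (r.+1 <= r'.+1)%N)).
apply: filterS => w /le_trans; apply.
(* [t + (r.+1 - t)] is at least [r.+1], also when [r < t] and the subtraction truncates. *)
have : K (t + (r.+1 - t))%N <= K r.
  by apply: (tail_nonincreasing k0 kK); apply: ltnW; rewrite -leq_subLR.
by move=> le_; exact: lerD.
Qed.

Let KKcvg : (fun r => K r + K r) @ \oo --> (0 : R).
Proof. by rewrite -(addr0 0); exact: cvgD. Qed.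

Definition Vlim t i : Omega -> R := flimsup (fun r => Vhat rho g c t r i).

Lemma Vlim_cvg t i : \forall w \ae P,
  Vhat rho g c t r i w @[r --> \oo] --> Vlim t i w.
Proof.
have := ae_flimsup KKcvg (fun r r' => @Vhat_dist t r r' i).
by apply: filterS => w [].
Qed.

Lemma Vhat_Vlim_dist t i : \forall w \ae P, forall r,
  `|Vhat rho g c t r i w - Vlim t i w| <= K r + K r.
Proof.
have := ae_flimsup KKcvg (fun r r' => @Vhat_dist t r r' i).
by apply: filterS => w [].
Qed.

Lemma Vlim_bound t i : \forall w \ae P, `|Vlim t i w| <= K t.
Proof.
have : \forall w \ae P, forall r, `|Vhat rho g c t r i w| <= K t.
  by apply: ae_foralln => r; exact: Vhat_rec_bound.
apply: filterS2 (Vhat_Vlim_dist t i) => w VV Vb.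
apply: (cvg0_le (N := 0) KKcvg) => r _.
rewrite -[X in `|X|](addrNK (Vhat rho g c t r i w)).
by rewrite (le_trans (ler_normD _ _)) // addrC lerD // distrC.
Qed.

Lemma Vlim_Linfty t i : Linfty P (G t) (Vlim t i).
Proof.
have mV : measurable_fun [set: g_sigma_algebraType (G t)]
    (Vlim t i : g_sigma_algebraType (G t) -> R).
  by apply: flimsup_measurable => r; case: (Vhat_rec_Linfty (r.+1 - t) t i).
split => //; apply/LfunooP; split; last by exists (K t); exact: Vlim_bound.
apply: (@measurableT_comp _ _ _ _ _ _ fine); first exact: fine_measurable.
apply: measurable_fun_limn_esup => r; apply/measurable_EFinP.
by have /Linfty_Lfun/LfunooP[] := Vhat_rec_Linfty (r.+1 - t) t i.
Qed.

Lemma Vlim_Lfun t i : Vlim t i \in L.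
Proof. exact: Linfty_Lfun (Vlim_Linfty t i). Qed.

(** The recursion passes to the limit because replacing [Vhat] by [Vlim] on its right-hand side
    changes it by at most [2 K r], by the Lipschitz property of [rho] and of the minimum. *)
Lemma Vlim_bellman t i : \forall w \ae P,
  Vlim t i w = minR (fun j => rho t (gtilde g c i j t \+ Vlim t.+1 j) w) i.
Proof.
have : \forall w \ae P, forall r, (t <= r)%N ->
    `|Vhat rho g c t r i w -
      minR (fun j => rho t (gtilde g c i j t \+ Vlim t.+1 j) w) i| <= K r + K r.
  apply: ae_foralln => r; have [tr|tr] := boolP (t <= r)%N; last exact: aeW.
  have : \forall w \ae P, forall j,
      `|rho t (gtilde g c i j t \+ Vhat rho g c t.+1 r j) w -
        rho t (gtilde g c i j t \+ Vlim t.+1 j) w| <= K r + K r.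
    apply: filter_forall => j; apply: (rho_dist hrho).
    - exact: continuation_Lfun (Linfty_Lfun (Vhat_rec_Linfty _ _ _)).
    - exact: continuation_Lfun (Vlim_Lfun _ _).
    - apply: filterS (Vhat_Vlim_dist t.+1 j) => w /(_ r).
      by rewrite /= opprD addrACA subrr add0r.
  by apply: filterS => w VV _; rewrite (Vhat_le rho g c i tr); exact: minR_dist.
apply: filterS2 (Vhat_Vlim_dist t i) => w VV VM.
(* Two [K r] come from each side of the equation; the recursion is available only from [r = t]
   on. *)
apply: (@cvg0_eq _ _ _ (fun r => (K r + K r) + (K r + K r)) t).
  by rewrite -(addr0 0); exact: cvgD.
move=> r tr; rewrite -[X in X - _](addrNK (Vhat rho g c t r i w)) -addrA.
rewrite (le_trans (ler_normD _ _)) // lerD //; first by rewrite distrC.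
exact: VM.
Qed.

(** * The Bellman equation along an adapted strategy *)

Section Strategy.
Variable xi : strategy Omega m.
Hypothesis adapted_xi : adapted G xi.
Local Notation cost := (strategy_cost g c xi).

Lemma adapted_mode_before s i : G s (mode_before xi s @^-1` [set i]).
Proof.
case: s => [|s]; last by case: hG => _ _ /(_ s s.+1 (leqnSn s)); apply.
rewrite -(filtration_measurableE hG) /=.
have [->|/eqP iN] := eqVneq (initial_mode xi) i.
  by rewrite preimage_cst mem_set //; exact: measurableT.
by rewrite preimage_cst memNset //; exact: measurable0.
Qed.

(** Old and new mode are both known at time [s], so the pair can serve as the index in
    [rho_select]. *)
Lemma adapted_modes s p :
  G s ((fun w => (mode_before xi s w, xi s w)) @^-1` [set p]).
Proof.
rewrite -(filtration_measurableE hG).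
apply: (@measurable_preimage_pair _ (g_sigma_algebraType (G s))) => i;
  rewrite (filtration_measurableE hG); [exact: adapted_mode_before|].
exact: adapted_xi.
Qed.

Lemma strategy_cost_Lfun s : cost s \in L.
Proof.
apply: (@Lfunoo_select _ _ _ _ _ (fun w => (mode_before xi s w, xi s w))
  (fun p => gtilde g c p.1 p.2 s)) => p; last exact: gtilde_Lfun.
exact: (filtration_measurable hG (adapted_modes s p)).
Qed.

Lemma strategy_cost_bound s : \forall w \ae P, `|cost s w| <= k s.
Proof.
have : \forall w \ae P, forall i j, `|gtilde g c i j s w| <= k s.
  by do 2 (apply: filter_forall => ?).
by apply: filterS => w; exact.
Qed.

Definition Vlim_along s w := Vlim s (mode_before xi s w) w.

Lemma Vlim_along_Lfun s : Vlim_along s \in L.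
Proof.
apply: Lfunoo_select => i; last exact: Vlim_Lfun.
exact: (filtration_measurable hG (adapted_mode_before s i)).
Qed.

Lemma Vlim_along_bound s : \forall w \ae P, `|Vlim_along s w| <= K s.
Proof.
have : \forall w \ae P, forall i, `|Vlim s i w| <= K s.
  by apply: filter_forall => i; exact: Vlim_bound.
by apply: filterS => w; exact.
Qed.

Lemma Vlim_along_bellman s : \forall w \ae P, let i := mode_before xi s w in
  Vlim_along s w = minR (fun j => rho s (gtilde g c i j s \+ Vlim s.+1 j) w) i.
Proof.
have : \forall w \ae P, forall i,
    Vlim s i w = minR (fun j => rho s (gtilde g c i j s \+ Vlim s.+1 j) w) i.
  by apply: filter_forall => i; exact: Vlim_bellman.
by apply: filterS => w; exact.
Qed.

(** Locality freezes the pair of modes. The next value fits this scheme because the mode before time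
    [s.+1] is [xi s]. *)
Lemma rho_Vlim_along s : \forall w \ae P,
  rho s (cost s \+ Vlim_along s.+1) w =
  rho s (gtilde g c (mode_before xi s w) (xi s w) s \+ Vlim s.+1 (xi s w)) w.
Proof.
apply: (@rho_select _ _ _ _ _ _ hG hrho _ _
  (fun w => (mode_before xi s w, xi s w))
  (fun p => gtilde g c p.1 p.2 s \+ Vlim s.+1 p.2)) => p.
  exact: adapted_modes.
exact: continuation_Lfun (Vlim_Lfun _ _).
Qed.

Lemma Vlim_along_le t :
  \forall w \ae P, ((Vlim_along t w)%:E <= agg_risk_infty rho t cost w)%E.
Proof.
apply: (verification_le hrho strategy_cost_Lfun strategy_cost_bound k0 K0 kK
  Kcvg Vlim_along_Lfun Vlim_along_bound) => s _.
(* The Bellman minimum is at most the value at the mode that the strategy chooses. *)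
by apply: filterS2 (Vlim_along_bellman s) (rho_Vlim_along s) => w -> ->; exact: minR_le.
Qed.

Lemma Vlim_along_ge t :
    (forall s, (t <= s)%N -> \forall w \ae P,
       argmin (fun j => risk_at rho g c s (mode_before xi s) j (Vlim s.+1 j) w)
         (xi s w)) ->
  \forall w \ae P, (agg_risk_infty rho t cost w <= (Vlim_along t w)%:E)%E.
Proof.
move=> xi_argmin.
apply: (verification_ge hrho strategy_cost_Lfun strategy_cost_bound k0 K0 kK
  Kcvg Vlim_along_Lfun Vlim_along_bound) => s ts.
apply: filterS3 (Vlim_along_bellman s) (rho_Vlim_along s) (xi_argmin s ts).
(* The chosen mode attains the Bellman minimum, so the required inequality holds as an equality. *)
move=> w -> -> xiw; rewrite le_eqVlt; apply/orP; left; apply/eqP.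
symmetry; apply: minR_argmin => j.
by have := xiw j; rewrite !risk_atE.
Qed.

End Strategy.
End Switching.

(** * Existence of an adapted greedy strategy *)

Section GreedyStrategy.
Context (R : realType) (d : measure_display) (Omega : measurableType d).
Variables (P : probability Omega R) (G : nat -> set (set Omega)).
Variable rho : nat -> (Omega -> R) -> (Omega -> R).
Hypotheses (hG : filtration G) (hrho : conditional_risk_mapping P G rho).
Variables (m : nat) (g : 'I_m -> nat -> Omega -> R)
  (c : 'I_m -> 'I_m -> nat -> Omega -> R).
Hypotheses (hg : forall i t, g i t \in Lfun P +oo)
  (hc : forall i j t, c i j t \in Lfun P +oo).
Variables (V : nat -> 'I_m -> Omega -> R) (t : nat) (i : 'I_m).
Hypothesis LV : forall s j, V s j \in Lfun P +oo.

(** The inner match spells out the mode before time [r], which keeps the recursion structural; at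
    [r = 0] it is the initial mode [i]. *)
Fixpoint greedy_mode (r : nat) (w : Omega) : 'I_m :=
  if (r < t)%N then i else
  let p := if r is r'.+1 then greedy_mode r' w else i in
  first_argmin (fun j => rho r (gtilde g c p j r \+ V r.+1 j) w) i.

Definition greedy := Strategy i greedy_mode.

Lemma greedy_modeE r : mode greedy r = fun w =>
  if (r < t)%N then i else first_argmin
    (fun j => rho r (gtilde g c (mode_before greedy r w) j r \+ V r.+1 j) w) i.
Proof. by apply/funext => w; case: r. Qed.

(** Strong induction on time. For each fixed previous mode the first minimiser of [G r]-measurable
    risks is [G r]-measurable, and inserting the previous mode, known by then, preserves this. *)
Lemma greedy_adapted : adapted G greedy.
Proof.
elim/ltn_ind => r IH j.
have mbefore p : (@measurable _ (g_sigma_algebraType (G r)))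
    (mode_before greedy r @^-1` [set p]).
  rewrite (filtration_measurableE hG); case: r IH => [|r] IH.
    rewrite -(filtration_measurableE hG) /= preimage_cst.
    by case: ifP => _; [exact: measurableT|exact: measurable0].
  by case: hG => _ _ /(_ r r.+1 (leqnSn r)); apply; exact: IH.
rewrite -(filtration_measurableE hG).
rewrite greedy_modeE; case: (boolP (r < t)%N) => rt.
  rewrite [X in measurable X]preimage_cst.
  by case: ifP => _; [exact: measurableT|exact: measurable0].
apply: (@measurable_preimage_select _ (g_sigma_algebraType (G r)) _ _ _
  (fun p w => first_argmin
    (fun j => rho r (gtilde g c p j r \+ V r.+1 j) w) i)) => // p.
apply: (@measurable_first_argmin _ (g_sigma_algebraType (G r)) _ _
  (fun j => rho r (gtilde g c p j r \+ V r.+1 j))) => l.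
by have [] : Linfty P (G r) (rho r (gtilde g c p l r \+ V r.+1 l))
  by apply: (crm_range hrho); exact: continuation_Lfun.
Qed.

Lemma greedyP : greedy_strategy P G rho g c V t i greedy.
Proof.
split => [|//|r rt|r tr].
- exact: greedy_adapted.
- by apply: aeW => w; rewrite greedy_modeE rt.
- apply: aeW => w; rewrite greedy_modeE ltnNge tr /= => j; rewrite !risk_atE.
  exact: (first_argminP (fun j => rho r (gtilde g c _ j r \+ V r.+1 j) w)).
Qed.

End GreedyStrategy.

(** * Identification of the value process and optimality *)

Lemma greedy_strategies_from (R : realType) (d : measure_display)
    (Omega : measurableType d) (P : probability Omega R)
    (G : nat -> set (set Omega)) (rho : nat -> (Omega -> R) -> (Omega -> R))
    (m : nat) (g : 'I_m -> nat -> Omega -> R)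
    (c : 'I_m -> 'I_m -> nat -> Omega -> R) (V : nat -> 'I_m -> Omega -> R)
    t i (xi : strategy Omega m) :
  greedy_strategy P G rho g c V t i xi -> strategies_from P G t i xi.
Proof.
(* The mode before [t] is the initial mode if [t = 0] and the mode at [t - 1] otherwise; a greedy
   strategy fixes both to [i]. *)
case=> axi xi0 xilt _; split => //; case: t xilt => [|t] xilt.
  by apply: aeW => w; rewrite /= xi0.
by apply: xilt.
Qed.

Lemma summably_bounded_tail (R : realType) (d : measure_display)
    (Omega : measurableType d) (P : probability Omega R)
    (W : nat -> Omega -> R) : summably_bounded P W ->
  exists k K : nat -> R,
    [/\ forall t, 0 <= k t, forall t, 0 <= K t, forall t, k t + K t.+1 = K t,
        K @ \oo --> (0 : R) & forall t, \forall w \ae P, `|W t w| <= k t].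
Proof.
case=> _ [k [k0 /(summable_tail k0)[K [K0 kK Kcvg]] Wk]].
by exists k, K.
Qed.

Theorem theorem3p5 (R : realType) (d : measure_display)
    (Omega : measurableType d) (P : probability Omega R)
    (G : nat -> set (set Omega)) (hG : filtration G)
    (rho : nat -> (Omega -> R) -> (Omega -> R))
    (hrho : conditional_risk_mapping P G rho)
    (m : nat)
    (g : 'I_m -> nat -> Omega -> R) (c : 'I_m -> 'I_m -> nat -> Omega -> R)
    (hg : forall i t, g i t \in Lfun P +oo)
    (hc : forall i j t, c i j t \in Lfun P +oo)
    (hc0 : forall i t, \forall w \ae P, c i i t w = 0)
    (gbar : nat -> Omega -> R) (hgbar : summably_bounded P gbar)
    (hbound : forall t i j,
       \forall w \ae P, `|gtilde g c i j t w| <= gbar t w) :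
  exists Vtilde : nat -> 'I_m -> Omega -> R,
    [/\ forall t i, Linfty P (G t) (Vtilde t i),
        forall t i, \forall w \ae P,
          Vhat rho g c t r i w @[r --> \oo] --> Vtilde t i w,
        forall t i, \forall w \ae P,
          (Vtilde t i w)%:E = value_process P G rho g c t i w
      & forall t i,
          (exists xi, greedy_strategy P G rho g c Vtilde t i xi) /\
          (forall xi, greedy_strategy P G rho g c Vtilde t i xi ->
             optimal_strategy P G rho g c t i xi)].
Proof.
have [k [K [k0 K0 kK Kcvg gbark]]] := summably_bounded_tail hgbar.
have gk t i j : \forall w \ae P, `|gtilde g c i j t w| <= k t.
  apply: filterS2 (hbound t i j) (gbark t) => w gw /(le_trans (ler_norm _)).
  exact: le_trans.
pose V := Vlim rho g c.
have LV t i : V t i \in Lfun P +oo by exact: (Vlim_Lfun hrho hg hc hc0 k0 K0 kK Kcvg gk).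
have exgreedy t i : greedy_strategy P G rho g c V t i (greedy rho g c V t i).
  exact: (greedyP hG hrho hg hc).
(* An admissible strategy enters time [t] in mode [i] almost surely, so the value along it is
   [V t i] there. *)
have Vle t i xi : strategies_from P G t i xi -> \forall w \ae P,
    ((V t i w)%:E <= agg_risk_infty rho t (strategy_cost g c xi) w)%E.
  move=> [axi xit].
  have := Vlim_along_le hG hrho hg hc hc0 k0 K0 kK Kcvg gk axi t.
  by apply: filterS2 xit => w xiw; rewrite /Vlim_along xiw.
have Veq t i xi : greedy_strategy P G rho g c V t i xi -> \forall w \ae P,
    agg_risk_infty rho t (strategy_cost g c xi) w = (V t i w)%:E.
  move=> gxi; have Uxi := greedy_strategies_from gxi; have [axi xit] := Uxi.
  have [_ _ _ gmin] := gxi.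
  have := Vlim_along_ge hG hrho hg hc hc0 k0 K0 kK Kcvg gk axi gmin.
  apply: filterS3 xit (Vle _ _ _ Uxi) => w xiw le1.
  by rewrite /Vlim_along xiw => le2; apply/eqP; rewrite eq_le le1 le2.
(* [V t i] is a measurable lower bound of all costs, hence at most the essential infimum; the greedy
   strategy attains it, which gives equality. *)
have Vvalue t i : \forall w \ae P, (V t i w)%:E = value_process P G rho g c t i w.
  have [|_ val_le le_val] := @ess_infimumP _ _ _ P
    [set agg_risk_infty rho t (strategy_cost g c xi)
    | xi in strategies_from P G t i].
    move=> _ [xi [axi _] <-]; apply: (agg_risk_infty_measurable hrho).
    exact: (strategy_cost_Lfun hG hg hc axi).
  have /val_le val_greedy : [set agg_risk_infty rho t (strategy_cost g c xi)
      | xi in strategies_from P G t i]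
      (agg_risk_infty rho t (strategy_cost g c (greedy rho g c V t i))).
    by eexists; first exact: greedy_strategies_from (exgreedy t i).
  have mV : measurable_fun [set: Omega] (EFin \o V t i).
    by apply/measurable_EFinP; have /LfunooP[] := LV t i.
  have /(le_val _ mV) V_val : forall X,
      [set agg_risk_infty rho t (strategy_cost g c xi)
      | xi in strategies_from P G t i] X -> \forall w \ae P, ((V t i w)%:E <= X w)%E.
    by move=> _ [xi Uxi <-]; exact: Vle.
  apply: filterS3 V_val val_greedy (Veq _ _ _ (exgreedy t i)) => w le1 + Ew.
  by rewrite Ew => le2; apply/eqP; rewrite eq_le le1.
exists V; split => // t i.
- exact: (Vlim_Linfty hrho hg hc hc0 k0 K0 kK Kcvg gk).
- exact: (Vlim_cvg hrho hg hc hc0 k0 K0 kK Kcvg gk).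
- split; first by eexists; exact: exgreedy.
  move=> xi gxi; split; first exact: greedy_strategies_from gxi.
  by apply: filterS2 (Veq _ _ _ gxi) (Vvalue t i) => w -> ->.
Qed.
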